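(* Let $(N,\mu,\nu)$ be an intuitionistic fuzzy normed space, let $(u_k)_{k\ge 1}$ be a sequence in $N$ and let $a\in N$. If $(u_k)$ is statistically logarithmic summable to $a$ and the sequence $\{k\ln k\,(u_k-u_{k-1})\}$ is q-bounded, then $(u_k)$ converges to $a$ in $(N,\mu,\nu)$.
   Context: An intuitionistic fuzzy normed space (IFNS) is a triple $(N,\mu,\nu)$ where $N$ is a real vector space with zero vector $\theta$ and $\mu,\nu:N\times\mathbb{R}\to[0,1]$ satisfy, for all $u,w\in N$ and $t,s\in\mathbb{R}$: (a) $\mu(u,t)=0$ for $t\le 0$; (b) $\mu(u,t)=1$ for all $t>0$ if and only if $u=\theta$; (c) $\mu(cu,t)=\mu(u,t/|c|)$ for all $t>0$ and real $c\ne 0$; (d) $\mu(u+w,t+s)\ge\min\{\mu(u,t),\mu(w,s)\}$; (e) $\lim_{t\to\infty}\mu(u,t)=1$, and $\lim_{t\to 0}\mu(u,t)=0$ if $u\neq\theta$; (f) $\nu(u,t)=1$ for $t\le 0$; (g) $\nu(u,t)=0$ for all $t>0$ if and only if $u=\theta$; (h) $\nu(cu,t)=\nu(u,t/|c|)$ for all $t>0$ and real $c\neq 0$; (i) $\max\{\nu(u,t),\nu(w,s)\}\ge\nu(u+w,t+s)$; (j) $\lim_{t\to\infty}\nu(u,t)=0$, and $\lim_{t\to0}\nu(u,t)=1$ if $u\ne\theta$. A sequence $(u_k)$ in $N$ is convergent to $a\in N$ if for every $\varepsilon>0$ and $t>0$ there is $k_0\in\mathbb{N}$ such that $\mu(u_k-a,t)>1-\varepsilon$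 and $\nu(u_k-a,t)<\varepsilon$ for all $k\ge k_0$. A sequence $(v_k)$ in $N$ is statistically convergent to $a\in N$ with respect to $(\mu,\nu)$ if for every $\varepsilon>0$ and $t>0$, $\lim_{n\to\infty}\frac1n\left|\{k\le n:\mu(v_k-a,t)\le 1-\varepsilon\text{ or }\nu(v_k-a,t)\ge\varepsilon\}\right|=0$. $(u_k)$ is statistically logarithmic summable to $a$ if the sequence $(\tau_k)$ of logarithmic means $\tau_k=\frac{1}{\ell_k}\sum_{j=1}^k\frac{u_j}{j}$, where $\ell_k=\sum_{j=1}^k\frac1j$, is statistically convergent to $a$. A sequence $(v_k)$ in $N$ is q-bounded if $\lim_{t\to\infty}\inf_{k}\mu(v_k,t)=1$ and $\lim_{t\to\infty}\sup_{k}\nu(v_k,t)=0$. In $\{k\ln k\,(u_k-u_{k-1})\}$ the convention $u_0=\theta$ is used (the term $k=1$ is $\theta$). *)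

(* Defs.v *)
From HB Require Import structures.
From mathcomp Require Import all_boot all_order all_algebra.
From mathcomp Require Import all_classical all_reals all_analysis.

Set Implicit Arguments.
Unset Strict Implicit.
Unset Printing Implicit Defensive.

Import Order.TTheory GRing.Theory Num.Theory.
Import numFieldNormedType.Exports.

Local Open Scope classical_set_scope.
Local Open Scope ring_scope.

Section IFNS.
Variables (R : realType) (N : lmodType R).

(* (N, mu, nu) is an intuitionistic fuzzy normed space. Limits at 0 are taken
   over the punctured two-sided neighbourhoods of 0. *)
Record is_ifns (mu nu : N -> R -> R) : Prop := IsIFNS {
  ifns_mu_itv : forall u t, 0 <= mu u t <= 1;
  ifns_nu_itv : forall u t, 0 <= nu u t <= 1;
  ifns_mu_le0 : forall u t, t <= 0 -> mu u t = 0;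
  ifns_mu_eq1 : forall u, (forall t, 0 < t -> mu u t = 1) <-> u = 0;
  ifns_muZ : forall u c t, 0 < t -> c != 0 -> mu (c *: u) t = mu u (t / `|c|);
  ifns_muD : forall u w t s, Num.min (mu u t) (mu w s) <= mu (u + w) (t + s);
  ifns_mu_cvgy : forall u, mu u t @[t --> +oo] --> (1 : R);
  ifns_mu_cvg0 : forall u, u != 0 -> mu u t @[t --> (0 : R)^'] --> (0 : R);
  ifns_nu_le0 : forall u t, t <= 0 -> nu u t = 1;
  ifns_nu_eq0 : forall u, (forall t, 0 < t -> nu u t = 0) <-> u = 0;
  ifns_nuZ : forall u c t, 0 < t -> c != 0 -> nu (c *: u) t = nu u (t / `|c|);
  ifns_nuD : forall u w t s, nu (u + w) (t + s) <= Num.max (nu u t) (nu w s);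
  ifns_nu_cvgy : forall u, nu u t @[t --> +oo] --> (0 : R);
  ifns_nu_cvg0 : forall u, u != 0 -> nu u t @[t --> (0 : R)^'] --> (1 : R)
}.

(* A sequence (v_k)_{k >= 1} is represented by a function v : nat -> N whose
   value at 0 is never used by the definitions below. *)

Definition ifns_cvg (mu nu : N -> R -> R) (v : nat -> N) (a : N) : Prop :=
  forall eps t : R, 0 < eps -> 0 < t ->
  exists k0 : nat, forall k : nat, (1 <= k)%N -> (k0 <= k)%N ->
    1 - eps < mu (v k - a) t /\ nu (v k - a) t < eps.

Definition ifns_stat_cvg (mu nu : N -> R -> R) (v : nat -> N) (a : N) : Prop :=
  forall eps t : R, 0 < eps -> 0 < t ->
  (#|[pred k : 'I_n.+1 | (1 <= k)%N &&
       ((mu (v k - a) t <= 1 - eps) || (eps <= nu (v k - a) t))]|%:R / n%:R : R)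
    @[n --> \oo] --> (0 : R).

Definition log_weight (k : nat) : R := \sum_(1 <= j < k.+1) j%:R^-1.

Definition log_mean (u : nat -> N) (k : nat) : N :=
  (log_weight k)^-1 *: \sum_(1 <= j < k.+1) (j%:R^-1 *: u j).

Definition stat_log_summable (mu nu : N -> R -> R) (u : nat -> N) (a : N)
  : Prop := ifns_stat_cvg mu nu (log_mean u) a.

Definition q_bounded (mu nu : N -> R -> R) (v : nat -> N) : Prop :=
  inf [set mu (v k) t | k in [set k : nat | (1 <= k)%N]] @[t --> +oo]
    --> (1 : R) /\
  sup [set nu (v k) t | k in [set k : nat | (1 <= k)%N]] @[t --> +oo]
    --> (0 : R).

(* u_k - u_(k-1) for k >= 1, with the convention that u_0 is the zero vector
   whatever the unused value u 0 is. *)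
Definition backward_diff (u : nat -> N) (k : nat) : N :=
  u k - (if (k <= 1)%N then 0 else u k.-1).

Definition log_diff (u : nat -> N) (k : nat) : N :=
  (k%:R * ln k%:R) *: backward_diff u k.

End IFNS.

(* Main.v *)
(* For a fixed [eps > 0] the function
     p x = inf {t > 0 | 1 - eps < mu x t /\ nu x t < eps}
   is a seminorm, because the triangle inequalities of an IFNS use [min] and
   [max]; this reduces the theorem to a Tauberian statement for one seminorm.
   Write [w k = u k - a], [L k = \sum_(j <= k) 1 / j] and [tau] for the
   logarithmic means of [w]. The increments of [w] are [O(1 / (k * L k))], hence
   [w k - tau k = O(1)] and the increments of [tau] are [O(1 / (k * L k))] too.
   So [tau] moves by [O(1 / L n)] over [(n, 2n]], a block which contains a good
   index by statistical convergence, and [tau --> 0] in the ordinary sense.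
   Finally, comparing [w n] with the weighted average of [w] over the indices
   [n < j <= m], where [m] is minimal with [L m >= (1 + d) * L n], costs [O(d)],
   while that average is [O(1 / d)] times the size of [tau]. *)
Require Import Defs.
From mathcomp Require Import all_boot all_order all_algebra.
From mathcomp Require Import all_classical all_reals all_analysis.
From mathcomp Require Import ring lra.

Set Implicit Arguments.
Unset Strict Implicit.
Unset Printing Implicit Defensive.

Import Order.TTheory GRing.Theory Num.Theory.
Import numFieldNormedType.Exports.

Local Open Scope classical_set_scope.
Local Open Scope ring_scope.

(** * Growth of the harmonic sums [L] *)

Section LogWeight.
Variable R : realType.
Local Notation L := (log_weight R).

Lemma log_weight0 : L 0 = 0.
Proof. by rewrite /log_weight big_geq. Qed.

Lemma log_weightS k : L k.+1 = L k + k.+1%:R^-1.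
Proof. by rewrite /log_weight big_nat_recr. Qed.

Lemma log_weight_le_S k : L k <= L k.+1.
Proof. by rewrite log_weightS lerDl invr_ge0. Qed.

Lemma log_weight_le m n : (m <= n)%N -> L m <= L n.
Proof. exact: (homo_leq lexx le_trans log_weight_le_S). Qed.

Lemma log_weightS_gt0 k : 0 < L k.+1.
Proof.
apply: lt_le_trans (log_weight_le (ltn0Sn k)).
by rewrite log_weightS log_weight0 add0r invr_gt0.
Qed.

Lemma log_weight_gt0 k : (0 < k)%N -> 0 < L k.
Proof. by case: k => // k _; exact: log_weightS_gt0. Qed.

Lemma log_weight_step_le1 k : L k.+1 <= L k + 1.
Proof. by rewrite log_weightS lerD2l invf_le1 // ler1n. Qed.

Lemma log_weight_unbounded (A : R) : exists n : nat, A <= L n.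
Proof.
apply: contrapT => /forallNP LA; apply: (@dvg_harmonic R).
apply: nondecreasing_is_cvgn.
  apply/nondecreasing_seqP => n.
  by rewrite /series /= big_nat_recr //= lerDl harmonic_ge0.
exists A => _ [n _ <-].
have -> : series harmonic n = L n.
  by rewrite /series /log_weight /= big_add1.
by case: (ltP (L n) A) => [/ltW //|An]; case: (LA n).
Qed.

Lemma log_weight_ge_eventually (A : R) :
  exists n0 : nat, forall n, (n0 <= n)%N -> A <= L n.
Proof.
have [n0 An0] := log_weight_unbounded A.
by exists n0 => n n0n; exact: le_trans An0 (log_weight_le n0n).
Qed.

(** Induction: [ln (1 - 1 / (k + 2)) <= - 1 / (k + 2)] says that the new term of [L] is at most the
    increment of [ln]. *)
Lemma log_weight_le_1Dln k : L k.+1 <= 1 + ln k.+1%:R.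
Proof.
elim: k => [|k IHk]; first by rewrite log_weightS log_weight0 add0r invr1 ln1 addr0.
rewrite log_weightS.
have k1 : (0 : R) < k.+1%:R by [].
have k2 : (0 : R) < k.+2%:R by [].
have : ln (1 + - k.+2%:R^-1) <= - (k.+2%:R^-1 : R).
  apply: le_ln1Dx; rewrite ltrN2 invf_lt1 // ltr1n //.
have -> : 1 + - k.+2%:R^-1 = k.+1%:R / k.+2%:R :> R.
  apply: (mulIf (lt0r_neq0 k2)).
  by rewrite mulrDl mulNr divfK ?mulVf ?gt_eqF// mul1r -natr1 addrK.
rewrite ln_div ?posrE //; move: IHk.
set A := L _; set B := ln _; set C := ln _; set D := _^-1; lra.
Qed.

(** This turns bounds in [k ln k] into bounds in [k * L k]. Indices start at 2, where the constant 1
    is absorbed by [ln k / ln 2 >= 1]. *)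
Lemma log_weight_le_ln k : L k.+2 <= (1 + (ln 2)^-1) * ln k.+2%:R.
Proof.
have ln2_gt0 : (0 : R) < ln 2 by rewrite ln_gt0 // ltr1n.
apply: le_trans (log_weight_le_1Dln _) _.
rewrite mulrDl mul1r addrC lerD2l -[leLHS](mulVf (lt0r_neq0 ln2_gt0)).
rewrite ler_pM2l ?invr_gt0 // ler_ln ?posrE // ler_nat //.
Qed.

End LogWeight.

(** * Tauberian theorem for one seminorm *)

Record seminorm (R : realType) (N : lmodType R) (p : N -> R) : Prop := {
  seminorm_ge0 : forall x, 0 <= p x;
  seminormD : forall x y, p (x + y) <= p x + p y;
  seminormZ : forall c x, p (c *: x) <= `|c| * p x
}.

Section Tauberian.
Variables (R : realType) (N : lmodType R) (p : N -> R) (w : nat -> N) (M : R).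
Hypothesis hp : seminorm p.
Local Notation L := (log_weight R).
Hypothesis w_step : forall k, p (w k.+2 - w k.+1) <= M / (k.+2%:R * L k.+2).

Lemma seminorm0 : p 0 = 0.
Proof.
apply/eqP; rewrite eq_le (seminorm_ge0 hp) andbT.
by have := seminormZ hp 0 0; rewrite scale0r normr0 mul0r.
Qed.

Lemma seminormN x : p (- x) <= p x.
Proof. by have := seminormZ hp (-1) x; rewrite scaleN1r normrN1 mul1r. Qed.

Lemma seminormB x y : p (x - y) <= p x + p y.
Proof. by apply: le_trans (seminormD hp _ _) _; rewrite lerD2l seminormN. Qed.

Lemma Tauberian_const_ge0 : 0 <= M.
Proof.
have := le_trans (seminorm_ge0 hp _) (w_step 0).
by rewrite pmulr_lge0 // invr_gt0 mulr_gt0 // log_weightS_gt0.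
Qed.

Definition log_sum (k : nat) : N := \sum_(1 <= j < k.+1) (j%:R^-1 *: w j).

Lemma log_sumS k : log_sum k.+1 = log_sum k + k.+1%:R^-1 *: w k.+1.
Proof. by rewrite /log_sum big_nat_recr. Qed.

(** This is [L k *: (w k - tau k)]; the scaling by [L k] gives it a simple recurrence. *)
Definition log_dev (k : nat) : N := L k *: w k - log_sum k.

Lemma log_devS k : log_dev k.+1 = log_dev k + L k *: (w k.+1 - w k).
Proof.
rewrite /log_dev log_sumS log_weightS scalerDl scalerBr.
rewrite opprD addrACA subrr addr0 [RHS]addrC addrA subrK //.
Qed.

(** By [log_devS], passing from [k - 1] to [k] costs at most [L (k - 1) * M / (k * L k) <= M / k],
    and these bounds add up to [M * L k]. *)
Lemma log_dev_le k : p (log_dev k) <= M * L k.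
Proof.
elim: k => [|[|k] IHk].
- by rewrite /log_dev /log_sum log_weight0 big_geq // scale0r subr0 mulr0 seminorm0.
(* Nothing bounds [w 1 - w 0], but its coefficient is [L 0 = 0]. *)
- rewrite log_devS log_weight0 scale0r addr0.
  apply: le_trans IHk _; rewrite ler_wpM2l ?Tauberian_const_ge0 //.
  exact: log_weight_le_S.
rewrite log_devS; apply: le_trans (seminormD hp _ _) _.
rewrite [in leRHS]log_weightS mulrDr; apply: lerD => //.
apply: le_trans (seminormZ hp _ _) _.
rewrite ger0_norm ?(ltW (log_weightS_gt0 _ _)) //.
apply: le_trans (ler_wpM2l (ltW (log_weightS_gt0 _ _)) (w_step _)) _.
rewrite invfM mulrCA ler_wpM2l ?Tauberian_const_ge0 // mulrCA ler_piMr //.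
by rewrite ler_pdivrMr ?log_weightS_gt0 // mul1r log_weight_le_S.
Qed.

Local Notation tau := (log_mean w).

Lemma log_mean_step k :
  tau k.+2 - tau k.+1 = (k.+2%:R^-1 / (L k.+1 * L k.+2)) *: log_dev k.+2.
Proof.
have := lt0r_neq0 (log_weightS_gt0 R k).
have := lt0r_neq0 (log_weightS_gt0 R k.+1).
rewrite /log_mean /log_dev -!/(log_sum _) log_sumS log_weightS.
set x := w _; set s := log_sum _; set l := L _; set d := _^-1 => ld0 l0.
have -> : (l + d) *: x - (s + d *: x) = l *: x - s.
  by rewrite scalerDl opprD addrACA addrAC addrA addrK addrC.
rewrite scalerBr scalerDr !scalerA addrAC -scalerBl addrC -scaleNr.
by congr (_ *: _ + _ *: _); field; rewrite ld0 l0.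
Qed.

Lemma log_mean_step_le k :
  p (tau k.+2 - tau k.+1) <= M / (k.+2%:R * L k.+1).
Proof.
have L1 := log_weightS_gt0 R k; have L2 := log_weightS_gt0 R k.+1.
rewrite log_mean_step; apply: le_trans (seminormZ hp _ _) _.
have c0 : 0 < k.+2%:R^-1 / (L k.+1 * L k.+2) by rewrite divr_gt0 ?mulr_gt0.
rewrite gtr0_norm //; apply: le_trans (ler_wpM2l (ltW c0) (log_dev_le _)) _.
rewrite le_eqVlt; apply/orP; left; apply/eqP; field.
by rewrite !lt0r_neq0.
Qed.

(** Each of the [i] steps is bounded by the bound for the first one, since the denominators
    increase. For [i <= n + 1] the total is at most [M / L n.+1]. *)
Lemma log_mean_block n i :
  p (tau (n.+1 + i)%N - tau n.+1) <= M * i%:R / (n.+1%:R * L n.+1).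
Proof.
elim: i => [|i IHi]; first by rewrite addn0 subrr seminorm0 mulr0 mul0r.
have -> : tau (n.+1 + i.+1)%N - tau n.+1 =
    (tau (n + i).+2 - tau (n + i).+1) + (tau (n.+1 + i)%N - tau n.+1).
  by rewrite addrA addSn addnS subrK.
apply: le_trans (seminormD hp _ _) _.
rewrite -natr1 mulrDr mulrDl mulr1 addrC; apply: lerD => //.
apply: le_trans (log_mean_step_le _) _.
have L1 := log_weightS_gt0 R n.
apply: ler_wpM2l; first exact: Tauberian_const_ge0.
rewrite lef_pV2 ?posrE ?mulr_gt0 ?log_weightS_gt0 //.
apply: ler_pM (ltW L1) _ _ => //.
  by rewrite ler_nat ltnS (leq_trans (leq_addr i n)).
by apply: log_weight_le; rewrite ltnS leq_addr.
Qed.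

Lemma log_mean_cvg0
    (tau_blocks : forall t, 0 < t -> exists n0 : nat, forall n, (n0 <= n)%N ->
       exists2 k : nat, (n < k <= n.*2)%N & p (tau k) <= t) t :
  0 < t -> exists n0 : nat, forall n, (n0 <= n)%N -> p (tau n) <= t.
Proof.
move=> t0; have t2 : 0 < t / 2 by rewrite divr_gt0.
have [n0 Hn0] := tau_blocks _ t2.
(* Beyond [n1] the drift [M / L n] over a block is at most [t / 2]. *)
have [n1 Hn1] := log_weight_ge_eventually (M / (t / 2)).
exists (maxn n0 n1).+1 => -[//|n]; rewrite ltnS geq_max => /andP[n0n n1n].
have [k /andP[nk k2n] tk] := Hn0 _ (leqW n0n).
rewrite -[tau n.+1](subKr (tau k)).
apply: le_trans (seminormB _ _) _; rewrite (splitr t); apply: lerD => //.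
rewrite -(subnKC (ltnW nk)); apply: le_trans (log_mean_block _ _) _.
have L1 := log_weightS_gt0 R n.
have ML := Hn1 _ (leqW n1n); rewrite ler_pdivrMr // in ML.
rewrite ler_pdivrMr ?mulr_gt0 //.
have -> : t / 2 * (n.+1%:R * L n.+1) = L n.+1 * (t / 2) * n.+1%:R by ring.
apply: ler_pM (Tauberian_const_ge0) _ ML _ => //.
by rewrite ler_nat leq_subLR addnn.
Qed.

(** For [j > n + 1], [1 / (j * L j) <= (1 / j) / L n.+1], and the terms [1 / j] sum to a difference
    of values of [L]. *)
Lemma seminorm_increment_le n i :
  p (w (n.+1 + i)%N - w n.+1) <= M / L n.+1 * (L (n.+1 + i)%N - L n.+1).
Proof.
elim: i => [|i IHi]; first by rewrite addn0 !subrr seminorm0 mulr0.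
have -> : w (n.+1 + i.+1)%N - w n.+1 =
    (w (n + i).+2 - w (n + i).+1) + (w (n.+1 + i)%N - w n.+1).
  by rewrite addrA addSn addnS subrK.
apply: le_trans (seminormD hp _ _) _.
rewrite addnS (log_weightS _ (n.+1 + i)) addrAC mulrDr [leRHS]addrC.
apply: lerD => //.
apply: le_trans (w_step _) _.
rewrite invfM mulrCA mulrC. apply: ler_wpM2r; first by rewrite invr_ge0.
apply: ler_wpM2l; first exact: Tauberian_const_ge0.
rewrite lef_pV2 ?posrE ?log_weightS_gt0 //.
by apply: log_weight_le; rewrite ltnS (leq_trans (leq_addr i n)).
Qed.

(** The vector is the sum of [(w j - w n.+1) / j] over the block, so the increment bound enters with
    total weight [L (n.+1 + i) - L n.+1], whence the square. *)
Lemma log_sum_block n i :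
  p (log_sum (n.+1 + i)%N - log_sum n.+1 - (L (n.+1 + i)%N - L n.+1) *: w n.+1)
    <= M / L n.+1 * (L (n.+1 + i)%N - L n.+1) ^+ 2.
Proof.
have ML : 0 <= M / L n.+1.
  by rewrite divr_ge0 ?Tauberian_const_ge0 // ltW // log_weightS_gt0.
elim: i => [|i IHi].
  by rewrite addn0 !subrr scale0r subr0 seminorm0 expr0n mulr0.
have := seminorm_increment_le n i.+1.
rewrite !addnS (log_weightS _ (n.+1 + i)) (log_sumS (n.+1 + i)); move: IHi.
set x := w n.+1; set y := w _.+1; set s := log_sum (_ + _); set s0 := log_sum _.
set l := L (_ + _); set l0 := L _; set d := _%:R^-1 => IHi Hy.
have -> : s + d *: y - s0 - (l + d - l0) *: x =
   (s - s0 - (l - l0) *: x) + d *: (y - x).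
  rewrite [l + d - l0]addrAC scalerDl scalerBr [s + _ - _]addrAC opprD.
  by rewrite addrACA.
have l0l : l0 <= l by apply: log_weight_le; rewrite leq_addr.
have d0 : 0 <= d by rewrite invr_ge0.
apply: le_trans (seminormD hp _ _) _.
apply: le_trans (lerD IHi (seminormZ hp _ _)) _; rewrite ger0_norm //.
apply: le_trans (lerD (lexx _) (ler_wpM2l d0 Hy)) _.
rewrite [d * _]mulrCA -mulrDr ler_wpM2l //.
(* With [x = l - l0], this is [x ^ 2 + d * (x + d) <= (x + d) ^ 2]. *)
have := mulr_ge0 (_ : 0 <= l - l0) d0; rewrite subr_ge0 => /(_ l0l); nra.
Qed.

Lemma seminorm_Tauberian
    (tau_blocks : forall t, 0 < t -> exists n0 : nat, forall n, (n0 <= n)%N ->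
       exists2 k : nat, (n < k <= n.*2)%N & p (tau k) <= t) t :
  0 < t -> exists n0 : nat, forall n, (n0 <= n)%N -> p (w n) <= t.
Proof.
move=> t0; have M0 := Tauberian_const_ge0.
(* [d] makes the block error [2 * M * d] at most [t / 2], with [M + 1] covering [M = 0]; [e]
   satisfies [2 * (1 + d) * e = t / 2 * d], so that the means contribute at most [t / 2]. *)
pose d : R := t / (4 * (M + 1)).
have d0 : 0 < d by rewrite divr_gt0 // mulr_gt0 // ltr_wpDl.
pose e : R := t * d / (4 * (1 + d)).
have d1 : 0 < 1 + d by rewrite addr_gt0.
have e0 : 0 < e by rewrite divr_gt0 // mulr_gt0.
have [n0 Hn0] := log_mean_cvg0 tau_blocks e0.
have [n1 Hn1] := log_weight_ge_eventually d^-1.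
exists (maxn n0 n1).+1 => -[//|n]; rewrite ltnS geq_max => /andP[n0n n1n].
have l0 := log_weightS_gt0 R n.
have dl : 1 <= d * L n.+1 by rewrite mulrC -ler_pdivrMr // div1r Hn1 // leqW.
have exm : exists m : nat, (1 + d) * L n.+1 <= L m := log_weight_unbounded _.
(* By minimality [L m.+1] exceeds [(1 + d) * L n.+1] by at most 1, hence by at most [d * L n.+1]; so
   the block weight [x] below lies between [d * L n.+1] and twice that. *)
case: (ex_minnP exm) => -[|m] Hm minm.
  by move: Hm; rewrite log_weight0 leNgt mulr_gt0.
have Lm : L m < (1 + d) * L n.+1.
  by rewrite ltNge; apply/negP => /minm; rewrite ltnn.
have nm : (n.+1 <= m.+1)%N.
  rewrite leqNgt; apply/negP => /ltnW mn.
  have := log_weight_le R mn; nra.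
have := log_sum_block n (m.+1 - n.+1); rewrite subnKC //.
have tm := Hn0 _ (leq_trans (leqW n0n) nm).
have tn := Hn0 _ (leqW n0n).
have LtauE k : log_sum k.+1 = L k.+1 *: tau k.+1.
  by rewrite scalerA mulfV ?scale1r // lt0r_neq0 // log_weightS_gt0.
have L1 := log_weight_step_le1 R m.
have lm := log_weightS_gt0 R m.
rewrite !LtauE; set z := (X in p X).
have zE : (L m.+1 - L n.+1) *: w n.+1 = L m.+1 *: tau m.+1 - L n.+1 *: tau n.+1 - z.
  by rewrite /z subKr.
move=> pz.
set x := L m.+1 - L n.+1 in pz zE *.
have x_ge : d * L n.+1 <= x by rewrite /x; lra.
have x_le : x <= 2 * (d * L n.+1) by rewrite /x; lra.
have x0 : 0 < x by apply: lt_le_trans x_ge; rewrite mulr_gt0.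
have pxw : p (x *: w n.+1) <= L m.+1 * e + L n.+1 * e + M / L n.+1 * x ^+ 2.
  rewrite zE; apply: le_trans (seminormB _ _) (lerD _ pz).
  apply: le_trans (seminormB _ _) (lerD _ _);
    apply: le_trans (seminormZ hp _ _) _;
    by rewrite gtr0_norm // ler_wpM2l // ltW.
have means_le : L m.+1 * e + L n.+1 * e <= t / 2 * x.
  apply: (@le_trans _ _ (t / 2 * (d * L n.+1))); last first.
    by rewrite ler_wpM2l // divr_ge0 // ltW.
  have -> : t / 2 * (d * L n.+1) = 2 * (1 + d) * L n.+1 * e.
    by rewrite /e; field; rewrite lt0r_neq0.
  by rewrite -mulrDl ler_wpM2r ?(ltW e0) //; lra.
have block_le : M / L n.+1 * x ^+ 2 <= t / 2 * x.
  rewrite expr2 mulrA ler_wpM2r ?(ltW x0) //.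
  apply: (@le_trans _ _ (M / L n.+1 * (2 * (d * L n.+1)))).
    by rewrite ler_wpM2l // divr_ge0 // ltW.
  have -> : M / L n.+1 * (2 * (d * L n.+1)) = t / 2 * (M / (M + 1)).
    by rewrite /d; field; rewrite !lt0r_neq0 // ltr_wpDl.
  rewrite ler_piMr ?divr_ge0 ?(ltW t0) // ler_pdivrMr ?ltr_wpDl //; lra.
have -> : w n.+1 = x^-1 *: (x *: w n.+1).
  by rewrite scalerA mulVf ?scale1r // lt0r_neq0.
apply: le_trans (seminormZ hp _ _) _.
rewrite gtr0_norm ?invr_gt0 // mulrC ler_pdivrMr //; lra.
Qed.

End Tauberian.

(** * Gauges of the fuzzy norm, and good indices in dyadic blocks *)

Lemma leq_card_ord_block n (P : pred nat) :
  (forall k, (n < k <= n.*2)%N -> P k) ->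
  (n <= #|[pred k : 'I_n.*2.+1 | P k]|)%N.
Proof.
move=> hP; pose f (i : 'I_n) : 'I_n.*2.+1 := inord (n.+1 + i).
have fE i : f i = (n.+1 + i)%N :> nat.
  by rewrite inordK // addSn ltnS -addnn ltn_add2l.
have f_inj : injective f.
  by move=> i j /(congr1 val) /=; rewrite !fE => /addnI /val_inj.
rewrite -[leqLHS](card_ord n) -(card_codom f_inj); apply: subset_leq_card.
apply/fintype.subsetP => _ /codomP [i ->]; rewrite inE; apply: hP.
by rewrite fE ltnS leq_addr addSn -addnn ltn_add2l ltn_ord.
Qed.

Section Gauge.
Variables (R : realType) (N : lmodType R) (mu nu : N -> R -> R).
Hypothesis hN : is_ifns mu nu.
Variable eps : R.
Hypothesis eps0 : 0 < eps.

Definition ifns_ball (t : R) (x : N) : Prop := 1 - eps < mu x t /\ nu x t < eps.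

(** The condition [0 < t] keeps the set bounded below when [eps > 1], a case in which every [t <= 0]
    satisfies [ifns_ball t x]. *)
Definition ifns_gauge (x : N) : R := inf [set t | 0 < t /\ ifns_ball t x].

Lemma ifns_ball0 t : 0 < t -> ifns_ball t 0.
Proof.
move=> t0; have [_ mu0] := ifns_mu_eq1 hN 0; have [_ nu0] := ifns_nu_eq0 hN 0.
by split; rewrite ?mu0 ?nu0 // ltrBlDr ltrDl.
Qed.

Lemma ifns_ballD s t x y :
  ifns_ball s x -> ifns_ball t y -> ifns_ball (s + t) (x + y).
Proof.
move=> [mx nx] [my ny]; split.
  by apply: lt_le_trans (ifns_muD hN _ _ _ _); rewrite lt_min mx my.
by apply: le_lt_trans (ifns_nuD hN _ _ _ _) _; rewrite gt_max nx ny.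
Qed.

(** Monotonicity in [t] comes from the triangle inequalities applied to [x + 0], with radius [t - s]
    for the zero vector. *)
Lemma ifns_ball_lt s t x : s < t -> ifns_ball s x -> ifns_ball t x.
Proof.
move=> st sx; rewrite -(subrKC s t) -[x]addr0; apply: ifns_ballD => //.
by apply: ifns_ball0; rewrite subr_gt0.
Qed.

Lemma ifns_ballZ c t x :
  c != 0 -> 0 < t -> ifns_ball t x -> ifns_ball (`|c| * t) (c *: x).
Proof.
move=> c0 t0 tx; have nc0 : 0 < `|c| by rewrite normr_gt0.
rewrite /ifns_ball (ifns_muZ hN) ?(ifns_nuZ hN) ?mulr_gt0 //.
by rewrite mulrC mulKf ?lt0r_neq0.
Qed.

Lemma ifns_ball_exists x : exists2 t, 0 < t & ifns_ball t x.
Proof.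
have mu1 : \forall t \near +oo, 1 - eps < mu x t.
  by apply: cvgr_gt (ifns_mu_cvgy hN x) _ _; rewrite ltrBlDr ltrDl.
have nu0 : \forall t \near +oo, nu x t < eps.
  exact: cvgr_lt (ifns_nu_cvgy hN x) _ eps0.
have : \forall t \near +oo, 0 < t /\ ifns_ball t x.
  by near=> t; split; [near: t; exact: nbhs_pinfty_gt|split; near: t].
by move=> /filter_ex [t []]; exists t.
Unshelve. all: by end_near. Qed.

Lemma has_inf_ifns_ball x : has_inf [set t | 0 < t /\ ifns_ball t x].
Proof.
split; first by have [t t0 tx] := ifns_ball_exists x; exists t.
by exists 0 => t [/ltW].
Qed.

Lemma ifns_gauge_le t x : 0 < t -> ifns_ball t x -> ifns_gauge x <= t.
Proof.
by move=> t0 tx; apply: ge_inf; [case: (has_inf_ifns_ball x)|split].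
Qed.

Lemma ifns_gauge_lt t x : ifns_gauge x < t ->
  exists2 s, s < t & 0 < s /\ ifns_ball s x.
Proof.
move=> xt.
have [|s sx st] := @inf_adherent _ _ (t - ifns_gauge x) _ (has_inf_ifns_ball x).
  by rewrite subr_gt0.
by exists s => //; move: st; rewrite subrKC.
Qed.

Lemma ifns_ball_gauge_lt t x : ifns_gauge x < t -> ifns_ball t x.
Proof. by move=> /ifns_gauge_lt [s st [_]]; exact: ifns_ball_lt. Qed.

Lemma ifns_gauge_ge0 x : 0 <= ifns_gauge x.
Proof.
by apply: lb_le_inf; [case: (has_inf_ifns_ball x)|move=> t [/ltW]].
Qed.

Lemma seminorm_ifns_gauge : seminorm ifns_gauge.
Proof.
split; first exact: ifns_gauge_ge0.
  move=> x y; apply/ler_addgt0Pr => e e0.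
  have e2 : 0 < e / 2 by rewrite divr_gt0.
  have [s sx [s0 bs]] : exists2 s, s < ifns_gauge x + e / 2 & 0 < s /\ ifns_ball s x.
    by apply: ifns_gauge_lt; rewrite ltrDl.
  have [t ty [t0 bt]] : exists2 t, t < ifns_gauge y + e / 2 & 0 < t /\ ifns_ball t y.
    by apply: ifns_gauge_lt; rewrite ltrDl.
  apply: le_trans (ifns_gauge_le _ (ifns_ballD bs bt)) _; first exact: addr_gt0.
  lra.
move=> c x; have [->|c0] := eqVneq c 0.
  rewrite scale0r normr0 mul0r; apply/ler_addgt0Pr => e e0.
  by rewrite add0r; apply: ifns_gauge_le => //; exact: ifns_ball0.
have nc0 : 0 < `|c| by rewrite normr_gt0.
rewrite mulrC -ler_pdivrMr //; apply: lb_le_inf.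
  by case: (has_inf_ifns_ball x).
move=> t [t0 tx]; rewrite ler_pdivrMr // mulrC.
by apply: ifns_gauge_le; [exact: mulr_gt0|exact: ifns_ballZ].
Qed.

Lemma q_bounded_ifns_ball (v : nat -> N) : q_bounded mu nu v ->
  exists2 t, 0 < t & forall k, (1 <= k)%N -> ifns_ball t (v k).
Proof.
move=> [mu_inf nu_sup].
have eps1 : 1 - eps < 1 by rewrite ltrBlDr ltrDl.
have mu1 := cvgr_gt _ mu_inf _ eps1.
have nu0 := cvgr_lt _ nu_sup _ eps0.
have [t [t0 [mt nt]]] : exists t : R, 0 < t /\
    (1 - eps < inf [set mu (v k) t | k in [set k : nat | (1 <= k)%N]] /\
     sup [set nu (v k) t | k in [set k : nat | (1 <= k)%N]] < eps).
  apply: (@filter_ex _ (pinfty_nbhs R)).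
  near=> t; split; first by near: t; exact: nbhs_pinfty_gt.
  by split; near: t; [exact: mu1|exact: nu0].
exists t => // k k1; split.
  apply: lt_le_trans mt _; apply: ge_inf; last by exists k.
  by exists 0 => _ [j _ <-]; case/andP: (ifns_mu_itv hN (v j) t).
apply: le_lt_trans nt; apply: ub_le_sup; last by exists k.
by exists 1 => _ [j _ <-]; case/andP: (ifns_nu_itv hN (v j) t).
Unshelve. all: by end_near. Qed.

(** Otherwise all [n] indices of [(n, 2n]] are bad, so bad indices have proportion at least 1/2 at
    rank [2n], against the limit 0. *)
Lemma ifns_stat_cvg_block (v : nat -> N) (a : N) t :
  ifns_stat_cvg mu nu v a -> 0 < t ->
  exists n0 : nat, forall n, (n0 <= n)%N ->
    exists2 k : nat, (n < k <= n.*2)%N & ifns_ball t (v k - a).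
Proof.
move=> va t0; have half0 : (0 : R) < 2^-1 by rewrite invr_gt0.
have [n0 _ Hn0] := cvgr_lt _ (va _ _ eps0 t0) _ half0.
exists n0.+1 => n n0n; apply: contrapT => nk.
have /= := Hn0 n.*2; rewrite -addnn (leq_trans (ltnW n0n)) ?leq_addr // addnn.
move=> /(_ isT); apply/negP; rewrite -leNgt.
have n_gt0 : (0 : R) < n%:R by rewrite ltr0n (leq_ltn_trans _ n0n).
rewrite ler_pdivlMr -?muln2 ?natrM ?mulr_gt0 // mulrCA mulVf // mulr1 muln2.
rewrite ler_nat; apply: (leq_card_ord_block (P := fun k => (1 <= k)%N &&
       ((mu (v k - a) t <= 1 - eps) || (eps <= nu (v k - a) t)))) => k knn.
have /andP[nltk _] := knn; rewrite (leq_ltn_trans _ nltk) //= -[_ || _]negbK.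
apply/negP; rewrite negb_or -!ltNge => /andP[b1 b2]; apply: nk.
by exists k.
Qed.

End Gauge.

(** * Translation by [a] and conclusion *)

Lemma log_meanB (R : realType) (N : lmodType R) (u : nat -> N) (a : N) k :
  (0 < k)%N -> log_mean (fun j => u j - a) k = log_mean u k - a.
Proof.
move=> k0; rewrite /log_mean.
have -> : \sum_(1 <= j < k.+1) (j%:R^-1 *: (u j - a)) =
    \sum_(1 <= j < k.+1) (j%:R^-1 *: u j) - log_weight R k *: a.
  rewrite /log_weight scaler_suml -sumrB; apply: eq_bigr => j _.
  by rewrite scalerBr.
by rewrite scalerBr scalerA mulVf ?scale1r // lt0r_neq0 // log_weight_gt0.
Qed.

Lemma log_diff_step (R : realType) (N : lmodType R) (p : N -> R)
    (hp : seminorm p) (u : nat -> N) (t : R) k :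
  p (log_diff u k.+2) <= t ->
  p (u k.+2 - u k.+1) <=
    t * (1 + (ln 2)^-1) / (k.+2%:R * log_weight R k.+2).
Proof.
rewrite /log_diff /backward_diff /= => ut.
have ln0 : (0 : R) < ln k.+2%:R by rewrite ln_gt0 // ltr1n.
have c0 : (0 : R) < k.+2%:R * ln k.+2%:R by rewrite mulr_gt0.
have l0 := log_weightS_gt0 R k.+1.
rewrite -[u _ - _](scalerK (lt0r_neq0 c0)).
apply: le_trans (seminormZ hp _ _) _; rewrite gtr0_norm ?invr_gt0 //.
have t0 : 0 <= t := le_trans (seminorm_ge0 hp _) ut.
apply: le_trans (ler_wpM2l _ ut) _; first by rewrite invr_ge0 ltW.
rewrite ler_pdivlMr ?mulr_gt0 // -mulrA ler_pdivrMl //.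
have -> : k.+2%:R * ln k.+2%:R * (t * (1 + (ln 2)^-1)) =
  (k.+2%:R * t) * ((1 + (ln 2)^-1) * ln k.+2%:R) :> R by ring.
rewrite mulrCA mulrA ler_wpM2l ?mulr_ge0 //.
exact: log_weight_le_ln.
Qed.

Theorem theorem3p7 (R : realType) (N : lmodType R) (mu nu : N -> R -> R)
    (hN : is_ifns mu nu) (u : nat -> N) (a : N)
    (hsum : stat_log_summable mu nu u a)
    (hbnd : q_bounded mu nu (log_diff u)) :
  ifns_cvg mu nu u a.
Proof.
move=> eps t eps0 t0.
have hp := seminorm_ifns_gauge hN eps0.
have [M M0 HM] := q_bounded_ifns_ball hN eps0 hbnd.
have w_step k : ifns_gauge mu nu eps ((u k.+2 - a) - (u k.+1 - a)) <=
    M * (1 + (ln 2)^-1) / (k.+2%:R * log_weight R k.+2).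
  rewrite opprB addrA subrK; apply: (log_diff_step hp).
  exact: ifns_gauge_le (HM _ _).
(* Membership in the ball of radius [t] requires a gauge strictly below [t], hence the target
   [t / 2]. *)
have t2 : 0 < t / 2 by rewrite divr_gt0.
have [s s0|k0 Hk0] := seminorm_Tauberian (w := fun k => u k - a) hp w_step _ t2.
  have [n0 Hn0] := ifns_stat_cvg_block eps0 hsum s0.
  exists n0 => n /Hn0 [k nk bk]; exists k => //.
  have /andP[nltk _] := nk.
  by rewrite log_meanB ?(leq_ltn_trans _ nltk) //; exact: ifns_gauge_le.
exists k0 => k _ /Hk0 uk; apply: ifns_ball_gauge_lt => //.
by apply: le_lt_trans uk _; rewrite ltr_pdivrMr // ltr_pMr // ltr1n.
Qed.
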